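(* Let $\mu$ be a probability measure on $\mathbb{R}$ whose support is not included in $(-\infty,0)$, and let $\phi(\lambda)=\int_{\mathbb{R}}e^{\lambda x}\,\mu(dx)\in(0,\infty]$, $\lambda\in\mathbb{R}$. Consider the conditions (a) there exists $\lambda<0$ such that $\phi(\lambda)<1$; (b) there exists $\lambda>0$ such that $\phi(\lambda)\in(1,\infty)$. The knowledge of the restrictions of the measures $\mu^{*n}$, $n\ge1$, to $[0,\infty)$ allows one to determine whether $\mu$ satisfies (a) and whether $\mu$ satisfies (b). When at least one of (a), (b) holds, $\mu\in\mathscr{C}$, i.e. every probability measure $\mu_1$ on $\mathbb{R}$ with $\mu_1^{*n}=\mu^{*n}$ on the Borel subsets of $[0,\infty)$ for all $n\ge1$ satisfies $\mu_1=\mu$.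
   Context: $\mu^{*n}$ is the $n$-fold convolution power of $\mu$. ''Determine'' means: if $\mu_1$ is a probability measure with $\mu_1^{*n}=\mu^{*n}$ on $[0,\infty)$ for all $n\ge1$, then $\mu_1$ satisfies (a) iff $\mu$ does, and $\mu_1$ satisfies (b) iff $\mu$ does. $\mathscr{C}$ is the set of probability measures on $\mathbb{R}$ determined in this sense by their convolution powers restricted to $[0,\infty)$. *)

(* Defs.v *)
From HB Require Import structures.
From mathcomp Require Import all_boot all_order all_algebra.
From mathcomp Require Import all_classical all_reals all_analysis.
Set Implicit Arguments. Unset Strict Implicit. Unset Printing Implicit Defensive.
Import Order.TTheory GRing.Theory Num.Theory.
Import numFieldNormedType.Exports.
Local Open Scope classical_set_scope.
Local Open Scope ring_scope.
Local Open Scope ereal_scope.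

Fixpoint convpow (R : realType) (mu : probability R R) (n : nat) : set R -> \bar R :=
  match n with
  | O => fun A => (0%R \in A)%:R%:E
  | S m => fun A => \int[mu]_x (convpow mu m [set y | (x + y)%R \in A])
  end.

Definition msupport (R : realType) (mu : probability R R) : set R :=
  [set x | forall e : R, (0 < e)%R -> 0 < mu (ball x e)].

Definition laplace (R : realType) (mu : probability R R) (l : R) : \bar R :=
  \int[mu]_x (expR (l * x))%:E.

Definition cond_a (R : realType) (mu : probability R R) : Prop :=
  exists l : R, (l < 0)%R /\ laplace mu l < 1.

Definition cond_b (R : realType) (mu : probability R R) : Prop :=
  exists l : R, (0 < l)%R /\ 1 < laplace mu l /\ laplace mu l < +oo.

Definition same_pos_convpows (R : realType) (mu1 mu : probability R R) : Prop :=
  forall n : nat, (0 < n)%N -> forall A : set R, measurable A ->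
    A `<=` `[0%R, +oo[ -> convpow mu1 n A = convpow mu n A.

(* Main.v *)
(** Write [S_n] for the random walk with step law [mu], [phi] for its Laplace
    transform, and split [phi(l)^n = E(e^{l S_n})] into the part on [S_n >= 0],
    which is common to [mu] and [mu1], and the part [r_n(l)] on [S_n < 0].
    Whenever both remainders satisfy [r_n(l) <= C q^n] with [q < phi(l)], the
    n-th powers of the two Laplace transforms at [l] are so close that the
    transforms agree at [l].
    - Under (b), [r_n(l) <= 1 < phi(l)], and this persists slightly to the left
      of [l].
    - Under (a), [P(S_n < 0) <= phi(l)^n] is exponentially small, for [mu1] as
      well as for [mu]. This forces an exponential left tail of the step law,
      and interpolation gives [r_n(s) <= 2 d^n] with [d < phi(s)] for all
      [s <= 0] close to 0.
    So the transforms agree on an interval; since [mu] and [mu1] coincide on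
    [x >= 0], so do the integrals of [e^{s x}] over [x < 0]. The limit
    [(2 e^{t x / n} - 1)^n --> e^{2 t x}], bounded by 1 for [x <= 0], doubles the
    length of this interval, hence it extends to a ray, and the polynomials
    [(1 - (1 - y^N)^n) (1 - y^n)^(n 2^n)] in [y = e^{c x}], which tend to the
    indicator of [y < 1/2], then recover the measure of every [x < a]. *)

Require Import Defs.
From HB Require Import structures.
From mathcomp Require Import all_boot all_order all_algebra.
From mathcomp Require Import all_classical all_reals all_analysis.
From mathcomp Require Import measurable_realfun ring lra.
Set Implicit Arguments.
Unset Strict Implicit.
Unset Printing Implicit Defensive.
Import Order.TTheory GRing.Theory Num.Theory.
Import numFieldNormedType.Exports.
Local Open Scope classical_set_scope.
Local Open Scope ring_scope.

(** * Elementary inequalities and limits for powers of real numbers *)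

Section real_sequences.
Variable R : realType.

Lemma bernoulli_ineq (x : R) n : -1 <= x -> 1 + n%:R * x <= (1 + x) ^+ n.
Proof.
move=> x1; elim: n => [|n IH]; first by rewrite mul0r addr0 expr0.
rewrite exprS; apply: le_trans (_ : (1 + x) * (1 + n%:R * x) <= _); last first.
  by rewrite ler_wpM2l//; lra.
have n0 : 0 <= n%:R :> R by [].
rewrite -natr1; have := sqr_ge0 x; rewrite expr2 => xx.
by have := mulr_ge0 n0 xx; lra.
Qed.

Lemma exprn_gt_bound (x C : R) : 1 < x -> exists2 n, (0 < n)%N & C < x ^+ n.
Proof.
move=> x1; exists (Num.truncn (C / (x - 1))).+1 => //.
set n := _.+1; have Cn : C / (x - 1) < n%:R by exact: truncnS_gt.
have x0 : -1 <= x - 1 by lra.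
have := bernoulli_ineq n x0; rewrite [1 + (x - 1)]addrC subrK.
apply: lt_le_trans; move: Cn; rewrite ltr_pdivrMr ?subr_gt0// => Cn.
by lra.
Qed.

Lemma le_of_exprn_le (a b C : R) : 0 < b ->
  (forall n, (0 < n)%N -> a ^+ n <= C * b ^+ n) -> a <= b.
Proof.
move=> b0 ab; rewrite leNgt; apply/negP => ba.
have r1 : 1 < a / b by rewrite ltr_pdivlMr// mul1r.
have [n n0] := exprn_gt_bound C r1; apply/negP; rewrite -leNgt.
by rewrite expr_div_n ler_pdivrMr ?exprn_gt0// ab.
Qed.

(** Taking n-th roots in [x^n <= (1 + C) max(y, q)^n] removes the constant and gives
    [x <= max(y, q)]; since [q < x], this means [x <= y]. The other direction is simpler, as
    [q^n <= x^n]. *)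
Lemma eq_of_exprn_close (x y q C : R) : 0 <= q -> q < x -> 0 <= y -> 0 <= C ->
  (forall n, (0 < n)%N -> x ^+ n <= y ^+ n + C * q ^+ n) ->
  (forall n, (0 < n)%N -> y ^+ n <= x ^+ n + C * q ^+ n) -> x = y.
Proof.
move=> q0 qx y0 C0 xy yx; have x0 : 0 < x by exact: le_lt_trans qx.
have leX (a b : R) n : 0 <= a -> a <= b -> a ^+ n <= b ^+ n.
  by move=> a0 ab; rewrite lerXn2r// nnegrE// (le_trans a0).
have xm : x <= Num.max y q.
  have [y0'|y0'] := ltP 0 (Num.max y q).
    apply: (@le_of_exprn_le _ _ (1 + C)) => // n n0; rewrite mulrDl mul1r.
    apply: (le_trans (xy _ n0)); rewrite lerD// ?ler_wpM2l//.
      by rewrite leX// le_max lexx.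
    by rewrite leX// le_max lexx orbT.
  (* Root extraction needs a positive base; if [y = q = 0], exponent one suffices. *)
  move: y0'; rewrite ge_max => /andP[y0' q0'].
  have := xy 1%N erefl; rewrite !expr1.
  have -> : y = 0 by apply/eqP; rewrite eq_le y0' y0.
  have -> : q = 0 by apply/eqP; rewrite eq_le q0' q0.
  by rewrite mulr0 addr0 maxxx.
have xley : x <= y by move: xm; rewrite le_max => /orP[//|]; rewrite leNgt qx.
apply/eqP; rewrite eq_le xley/=.
apply: (@le_of_exprn_le _ _ (1 + C)) => // n n0; rewrite mulrDl mul1r.
by rewrite (le_trans (yx _ n0))// lerD2l ler_wpM2l// leX// ltW.
Qed.

Lemma cvg_le_dist (u v : nat -> R) (a : R) : v @ \oo --> 0 ->
  (forall n, `|u n - a| <= v n) -> u @ \oo --> a.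
Proof.
move=> v0 uv; apply/subr_cvg0; apply: norm_cvg0.
apply: (squeeze_cvgr _ (cvg_cst 0) v0).
by apply: nearW => n; rewrite normr_ge0/= uv.
Qed.

Lemma dist_exprn_le (a b : R) n : `|a| <= 1 -> `|b| <= 1 ->
  `|a ^+ n - b ^+ n| <= n%:R * `|a - b|.
Proof.
move=> a1 b1; elim: n => [|n IH]; first by rewrite !expr0 subrr normr0 mul0r.
have -> : a ^+ n.+1 - b ^+ n.+1 = a * (a ^+ n - b ^+ n) + (a - b) * b ^+ n.
  by rewrite !exprS; ring.
rewrite (le_trans (ler_normD _ _))// !normrM -natr1 mulrDl mul1r lerD//.
  by rewrite (le_trans _ IH)// ler_piMl.
by rewrite ler_piMr// normrX exprn_ile1.
Qed.

(** With [u = e^w], [w = z/(n+1)], the bases [2u - 1] and [u^2] differ by [(1 - u)^2 <= w^2]. Both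
    lie in [-1, 1], so their powers differ by at most [(n+1) w^2 = z^2/(n+1)]. *)
Lemma cvg_double_expR (z : R) : z <= 0 ->
  (2 * expR (z / n.+1%:R) - 1) ^+ n.+1 @[n --> \oo] --> expR (2 * z).
Proof.
move=> z0; apply: (@cvg_le_dist _ (fun n => z ^+ 2 * harmonic n)).
  by rewrite -[X in _ --> X](mulr0 (z ^+ 2)); apply: cvgMr; exact: cvg_harmonic.
move=> n; set w := z / _; set u := expR w.
have n0 : 0 < n.+1%:R :> R by [].
have w0 : w <= 0 by rewrite /w mulr_le0_ge0// invr_ge0 ltW.
have u1 : u <= 1 by rewrite /u -expR0 ler_expR.
have u0 : 0 < u by exact: expR_gt0.
have -> : expR (2 * z) = (u ^+ 2) ^+ n.+1.
  have {1}-> : z = n.+1%:R * w by rewrite /w mulrC divfK// gt_eqF.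
  by rewrite mulrA -natrM expRM_natl exprM.
apply: le_trans (dist_exprn_le _ _ _) _.
- by rewrite ler_norml; lra.
- by rewrite normrX exprn_ile1// gtr0_norm.
have -> : 2 * u - 1 - u ^+ 2 = - (1 - u) ^+ 2 by ring.
have -> : z ^+ 2 * harmonic n = n.+1%:R * w ^+ 2.
  by rewrite /w /harmonic /=; field; rewrite gt_eqF.
rewrite normrN normrX ler_wpM2l// ger0_norm ?subr_ge0//.
rewrite -[w ^+ 2]sqrrN lerXn2r// ?nnegrE ?subr_ge0// ?oppr_ge0//.
by have := expR_ge1Dx w; rewrite -/u; lra.
Qed.

(** Bernoulli for [(r/q)^n], with [r] halfway between [q] and 1, shows that the factor [n] costs no
    more than replacing [q] by [r]. *)
Lemma cvg_natr_exprn (q : R) : 0 < q < 1 -> n%:R * q ^+ n @[n --> \oo] --> 0.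
Proof.
move=> /andP[q0 q1]; pose r := (1 + q) / 2; pose d := r / q - 1.
have d0 : 0 < d by rewrite /d subr_gt0 ltr_pdivlMr// mul1r /r; lra.
apply: (@cvg_le_dist _ (fun n => d^-1 * r ^+ n)).
  rewrite -[X in _ --> X](mulr0 d^-1); apply: cvgMr; apply: cvg_expr.
  by rewrite ger0_norm /r; lra.
move=> n; rewrite subr0 ger0_norm ?mulr_ge0 ?exprn_ge0 ?(ltW q0)//.
rewrite [leRHS]mulrC ler_pdivlMr// mulrAC -ler_pdivlMr ?exprn_gt0//.
rewrite -expr_div_n.
have d1 : -1 <= d by lra.
have := bernoulli_ineq n d1; rewrite {2}/d [1 + (_ - 1)]addrC subrK.
by apply: le_trans; rewrite lerDr.
Qed.

(** The first factor tends to 1. By Bernoulli the second is at least [1 - n (2y)^n], which tends to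
    1 for [y < 1/2]; for [y >= 1/2] it is at most [1/(n+1)]. *)
Lemma cvg_step (y : R) (N : nat) : 0 < y < 1 -> (0 < N)%N ->
  (1 - (1 - y ^+ N) ^+ n) * (1 - y ^+ n) ^+ (n * 2 ^ n) @[n --> \oo]
  --> ((y < 2^-1)%R%:R : R).
Proof.
move=> /andP[y0 y1] N0.
have yn01 k : 0 <= 1 - y ^+ k <= 1.
  by rewrite subr_ge0 exprn_ile1 ?(ltW y0) ?(ltW y1)//= gerBl exprn_ge0// ltW.
have A01 n : 0 <= (1 - y ^+ N) ^+ n <= 1.
  by have /andP[? ?] := yn01 N; rewrite exprn_ge0//= exprn_ile1.
have B01 n : 0 <= (1 - y ^+ n) ^+ (n * 2 ^ n) <= 1.
  by have /andP[? ?] := yn01 n; rewrite exprn_ge0//= exprn_ile1.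
have Mu n : (n * 2 ^ n)%:R * y ^+ n = n%:R * (2 * y) ^+ n.
  by rewrite natrM natrX exprMn mulrA.
case: ltP => y2.
  apply: (@cvg_le_dist _ (fun n => (1 - y ^+ N) ^+ n + n%:R * (2 * y) ^+ n)).
    rewrite -[X in _ --> X](addr0 0); apply: cvgD; last first.
      by apply: cvg_natr_exprn; lra.
    apply: cvg_expr; rewrite ger0_norm; last by case/andP: (yn01 N).
    by rewrite gtrBl exprn_gt0.
  move=> n; have := A01 n; have := B01 n.
  set A := (1 - _ ^+ N) ^+ n; set B := _ ^+ _.
  have u1 : -1 <= - y ^+ n by rewrite lerN2 exprn_ile1// ?(ltW y0) ?(ltW y1).
  have := bernoulli_ineq (n * 2 ^ n) u1; rewrite mulrN Mu -/B.
  set C := _ * _ => BC /andP[B0 B1] /andP[A0 A1].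
  have AB0 := mulr_ge0 A0 B0; have AB1 : A * B <= A by rewrite ler_piMr.
  by rewrite ler_norml mulrBl mul1r /=; lra.
apply: (@cvg_le_dist _ harmonic); first exact: cvg_harmonic.
move=> n; have := A01 n; have /= := B01 n.
set A := (1 - _ ^+ N) ^+ n; set B := _ ^+ _.
move=> /andP[B0 B1] /andP[A0 A1].
rewrite subr0 ger0_norm ?mulr_ge0 ?subr_ge0//.
apply: (@le_trans _ _ B); first by rewrite ler_piMl// gerBl.
rewrite /harmonic /= -[leRHS]mul1r ler_pdivlMr//.
have u0 : 0 <= y ^+ n by rewrite exprn_ge0// ltW.
have u1 : -1 <= y ^+ n by lra.
(* Since [2y >= 1], Bernoulli bounds the new factor below by [1 + n (2y)^n >= n + 1], while its
   product with [B] is a power of [1 - y^(2n) <= 1]. *)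
apply: (@le_trans _ _ (B * (1 + y ^+ n) ^+ (n * 2 ^ n))).
  rewrite ler_wpM2l// (le_trans _ (bernoulli_ineq (n * 2 ^ n) u1))//.
  rewrite Mu -natr1 addrC lerD2l ler_peMr// exprn_ege1//; lra.
rewrite /B -exprMn exprn_ile1//.
  by have /andP[? ?] := yn01 n; rewrite mulr_ge0// addr_ge0.
by have := sqr_ge0 (y ^+ n); rewrite expr2; lra.
Qed.

End real_sequences.

Lemma measurable_expRM (R : realType) (l : R) D :
  measurable_fun D (fun x : R => expR (l * x)).
Proof. by apply: (measurableT_comp (f := @expR R)). Qed.

Lemma measurable_EFin_expRM (R : realType) (l : R) D :
  measurable_fun D (fun x : R => (expR (l * x))%:E).
Proof. by apply/measurable_EFinP; exact: measurable_expRM. Qed.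

Lemma EFin_expR_ge0 (R : realType) (x : R) : (0 <= (expR x)%:E)%E.
Proof. by rewrite lee_fin expR_ge0. Qed.

#[local] Hint Extern 0 (measurable_fun _ (fun x => (expR (_ * x))%:E)) =>
  solve [exact: measurable_EFin_expRM] : core.
#[local] Hint Extern 0 (is_true (0 <= (expR _)%:E)%E) =>
  solve [exact: EFin_expR_ge0] : core.

(** * Convolution powers as measures, and their Laplace transforms *)

Section convolution.
Variable R : realType.
Implicit Types m : probability R R.

Definition addp (p : R * R) : R := p.1 + p.2.

Lemma measurable_addp : measurable_fun [set: R * R] addp.
Proof. exact: measurable_funD. Qed.

HB.instance Definition _ := isMeasurableFun.Build _ _ _ _ addp measurable_addp.

Definition mconv m1 m2 : probability R R := distribution (m1 \x m2)%E addp.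

Lemma mconvE m1 m2 A : mconv m1 m2 A = (\int[m1]_x m2 [set y | (x + y)%R \in A])%E.
Proof.
rewrite /mconv /distribution/pushforward /product_measure1 /=.
by apply: eq_integral => x _ /=; congr (m2 _).
Qed.

Lemma ge0_integral_conv m1 m2 (f : R -> \bar R) :
  measurable_fun setT f -> (forall x, (0 <= f x)%E) ->
  (\int[mconv m1 m2]_x f x = \int[m1]_x \int[m2]_y f (x + y)%R)%E.
Proof.
move=> mf f0; rewrite /mconv ge0_integral_distribution//.
rewrite fubini_tonelli1//; last by move=> p; exact: f0.
by apply: measurableT_comp => //; exact: measurable_addp.
Qed.

(** [convpow] is a bare set function; the same recursion is bundled here as a probability measure,
    the law of [S_n], so that one can integrate against it. *)
Fixpoint convn m (n : nat) : probability R R :=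
  if n is k.+1 then mconv m (convn m k) else dirac (0 : R).

Lemma convnE m n A : convpow m n A = convn m n A.
Proof.
elim: n A => [A|n IH A]; first by rewrite /= /dirac indicE.
by rewrite [RHS]mconvE; apply: eq_integral => x _; exact: IH.
Qed.

Local Notation neg := `]-oo, (0 : R)[%classic.
Local Notation pos := `[(0 : R), +oo[%classic.

(** At [convn m n] this is the remainder [r_n(l)], and [laplace_pos] is the part common to both
    measures. *)
Definition laplace_neg m (l : R) : \bar R := (\int[m]_(x in neg) (expR (l * x))%:E)%E.
Definition laplace_pos m (l : R) : \bar R := (\int[m]_(x in pos) (expR (l * x))%:E)%E.

Lemma negUpos : neg `|` pos = setT.
Proof. by rewrite -[pos]setCitvl setUv. Qed.

Lemma laplace_split m l : laplace m l = (laplace_neg m l + laplace_pos m l)%E.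
Proof.
rewrite /laplace -negUpos ge0_integral_setU//.
by rewrite -[pos]setCitvl; apply/disj_setPCl.
Qed.

Lemma laplace_ge0 m l : (0 <= laplace m l)%E.
Proof. exact: integral_ge0. Qed.

Lemma laplace_neg_ge0 m l : (0 <= laplace_neg m l)%E.
Proof. exact: integral_ge0. Qed.

Lemma laplace_pos_ge0 m l : (0 <= laplace_pos m l)%E.
Proof. exact: integral_ge0. Qed.

Lemma laplace_conv m1 m2 l :
  laplace (mconv m1 m2) l = (laplace m1 l * laplace m2 l)%E.
Proof.
rewrite /laplace ge0_integral_conv//.
under eq_integral => x _.
  under eq_integral do rewrite mulrDr expRD EFinM.
  rewrite ge0_integralZl//.
  over.
by rewrite /= ge0_integralZr// laplace_ge0.
Qed.

Lemma laplace_convn m n l : laplace (convn m n) l = (laplace m l ^+ n)%E.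
Proof.
elim: n => [|n IH]; last first.
  by rewrite expeS -IH; exact: laplace_conv.
by rewrite /laplace integral_dirac//= diracT mul1e mulr0 expR0.
Qed.

Lemma laplace_convn1 m l : laplace (convn m 1) l = laplace m l.
Proof. by rewrite laplace_convn. Qed.

Lemma convn1 m A : measurable A -> convn m 1 A = m A.
Proof.
move=> mA; rewrite mconvE; transitivity (\int[m]_x (\1_A x)%:E)%E; last first.
  by rewrite integral_indic// setIT.
apply: eq_integral => x _; rewrite /= diracE indicE.
rewrite (_ : (0 \in _) = (x \in A))//; apply/idP/idP => [/set_mem/=|xA].
  by rewrite addr0.
by apply/mem_set; rewrite /= addr0.
Qed.

Lemma laplace_neg_le1 m l : 0 <= l -> (laplace_neg m l <= 1)%E.
Proof.
move=> l0; rewrite -(@probability_setT _ _ _ m).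
rewrite (@le_trans _ _ (m neg))//; last by rewrite le_measure// inE.
rewrite -[leRHS]mul1e -integral_cst//; apply: ge0_le_integral => //.
move=> x /=; rewrite in_itv/= => x0; rewrite lee_fin -expR0 ler_expR.
by rewrite mulr_ge0_le0// ltW.
Qed.

Section same.
Variables m1 m2 : probability R R.
Hypothesis same : same_pos_convpows m1 m2.

Lemma same_convn n A : (0 < n)%N -> measurable A -> A `<=` pos ->
  convn m1 n A = convn m2 n A.
Proof. by move=> n0 mA Apos; have := same n0 mA Apos; rewrite !convnE. Qed.

Lemma same_laplace_pos n l : (0 < n)%N ->
  laplace_pos (convn m1 n) l = laplace_pos (convn m2 n) l.
Proof. by move=> n0; apply: eq_measure_integral => A; exact: same_convn. Qed.

Lemma same_neg n : (0 < n)%N -> convn m1 n neg = convn m2 n neg.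
Proof.
by move=> n0; rewrite -setCitvr !probability_setC// same_convn.
Qed.

End same.

End convolution.

(** * Recovering a measure on the negative half-line from its exponential integrals *)

Section uniqueness.
Variable R : realType.
Variables m1 m2 : probability R R.
Local Notation neg := `]-oo, (0 : R)[%classic.

(** Integrability is included so that the class is stable under linear combinations. *)
Definition agree (f : R -> R) :=
  [/\ m1.-integrable neg (EFin \o f), m2.-integrable neg (EFin \o f) &
      (\int[m1]_(x in neg) (f x)%:E = \int[m2]_(x in neg) (f x)%:E)%E].

Lemma agree0 : agree (fun=> 0).
Proof.
by split; [exact: integrable0|exact: integrable0|rewrite !integral0].
Qed.

Lemma agreeD f g : agree f -> agree g -> agree (fun x => f x + g x).
Proof.
move=> [f1 f2 fE] [g1 g2 gE]; split.
- exact: (integrableD _ f1 g1).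
- exact: (integrableD _ f2 g2).
- by rewrite !(integralD_EFin (measurable_itv _))// fE gE.
Qed.

Lemma agreeZ c f : agree f -> agree (fun x => c * f x).
Proof.
move=> [f1 f2 fE]; split.
- exact: (integrableZl _ c f1).
- exact: (integrableZl _ c f2).
- under eq_integral do rewrite EFinM.
  under [RHS]eq_integral do rewrite EFinM.
  by rewrite !(integralZl (measurable_itv _))//= fE.
Qed.

Lemma agree_sum n (F : nat -> R -> R) (c : nat -> R) :
  (forall i, (i < n)%N -> agree (F i)) ->
  agree (fun x => \sum_(i < n) c i * F i x).
Proof.
elim: n => [|n IH] aF.
  by under eq_fun do rewrite big_ord0; exact: agree0.
under eq_fun do rewrite big_ord_recr/=.
by apply: agreeD; [apply: IH => i /ltnW; exact: aF|exact/agreeZ/aF].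
Qed.

Lemma agree_horner (l h : R) (p : {poly R}) :
  (forall i, (i < size p)%N -> agree (fun x => expR ((l + i%:R * h) * x))) ->
  agree (fun x => expR (l * x) * p.[expR (h * x)]).
Proof.
move=> /(@agree_sum _ _ (fun i => p`_i)); congr agree; apply/funext => x.
rewrite horner_coef mulr_sumr; apply: eq_bigr => i _.
by rewrite mulrDl expRD mulrCA -mulrA expRM_natl.
Qed.

Lemma agree_lim (f_ : nat -> R -> R) (f g : R -> R) :
  (forall n, agree (f_ n)) ->
  m1.-integrable neg (EFin \o g) -> m2.-integrable neg (EFin \o g) ->
  (forall n (x : R), x < 0 -> `|f_ n x| <= g x) ->
  (forall x : R, x < 0 -> f_ ^~ x @ \oo --> f x) -> agree f.
Proof.
move=> af g1 g2 fg ff.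
have mf_ n : measurable_fun neg (EFin \o f_ n).
  by have [/measurable_int] := af n.
have mf : measurable_fun neg (EFin \o f).
  apply/measurable_EFinP; apply: (@measurable_fun_cvg _ _ _ _ f_) => [n|x /=].
    by apply/measurable_EFinP; exact: mf_.
  by rewrite in_itv/=; exact: ff.
have dom (m : probability R R) : m.-integrable neg (EFin \o g) ->
    m.-integrable neg (EFin \o f) /\
    (\int[m]_(x in neg) (f_ n x)%:E @[n --> \oo] --> \int[m]_(x in neg) (f x)%:E)%E.
  move=> ig.
  have [] := @dominated_convergence _ _ _ m neg (measurable_itv _)
    (fun n => EFin \o f_ n) (EFin \o f) (EFin \o g) mf_ mf _ ig _ => //.
  - apply: aeW => x /=; rewrite in_itv/= => x0.
    by apply: cvg_comp (ff _ x0) _; exact: cvg_id.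
  - by apply: aeW => x n /=; rewrite in_itv/= => x0; rewrite lee_fin fg.
have [i1 c1] := dom _ g1; have [i2 c2] := dom _ g2; split => //.
rewrite -(cvg_lim _ c1)// -(cvg_lim _ c2)//; apply: congr_lim.
by apply/funext => n; have [] := af n.
Qed.

(* On the negative half-line [2 e^{tx/n} - 1] stays in [-1, 1] and its n-th power
   tends to [e^{2tx}], while only exponents in [0, t] occur in its expansion. *)
Lemma agree_double (l h : R) : 0 <= h ->
  (forall s, l <= s <= l + h -> agree (fun x => expR (s * x))) ->
  forall s, l <= s <= l + 2 * h -> agree (fun x => expR (s * x)).
Proof.
move=> h0 al s /andP[ls slh]; pose t := (s - l) / 2.
have t0 : 0 <= t by rewrite /t; lra.
have th : t <= h by rewrite /t; lra.
pose p n : {poly R} := 2 ^+ n *: ('X - (2^-1)%:P) ^+ n.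
have pE n y : (p n).[y] = (2 * y - 1) ^+ n.
  by rewrite /p !hornerE -exprMn mulrBr divff.
apply: (@agree_lim (fun n x => expR (l * x) * (p n.+1).[expR (t / n.+1%:R * x)])
  _ (fun x => expR (l * x))).
- move=> n; apply: agree_horner => i.
  rewrite size_scale ?expf_neq0// size_exp_XsubC ltnS => i_n; apply: al.
  apply/andP; split; first by rewrite lerDl mulr_ge0// divr_ge0.
  rewrite lerD2l (le_trans _ th)//.
  by rewrite mulrCA ler_piMr// ler_pdivrMr// mul1r ler_nat.
- by have [] := al l; rewrite ?lexx ?lerDl.
- by have [] := al l; rewrite ?lexx ?lerDl.
- move=> n x x0; rewrite normrM ger0_norm ?expR_ge0// ler_piMr ?expR_ge0//.
  rewrite pE normrX exprn_ile1//.
  have u0 := expR_gt0 (t / n.+1%:R * x).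
  have : expR (t / n.+1%:R * x) <= 1.
    have tn0 : 0 <= t / n.+1%:R by exact: divr_ge0.
    by rewrite -[leRHS]expR0 ler_expR; exact: mulr_ge0_le0 (ltW x0).
  by rewrite ler_norml; lra.
- move=> x x0.
  have -> : expR (s * x) = expR (l * x) * expR (2 * (t * x)).
    by rewrite -expRD /t; congr expR; field.
  apply: cvgMr; under eq_cvg do rewrite pE mulrAC.
  by apply: cvg_double_expR; rewrite mulr_ge0_le0// ltW.
Qed.

Lemma agree_ray (l h : R) : 0 < h ->
  (forall s, l <= s <= l + h -> agree (fun x => expR (s * x))) ->
  forall s, l <= s -> agree (fun x => expR (s * x)).
Proof.
move=> h0 al s ls.
have all n : forall s, l <= s <= l + 2 ^+ n * h -> agree (fun x => expR (s * x)).
  elim: n => [|n IH]; first by rewrite mul1r.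
  rewrite exprS -mulrA; apply: agree_double => //.
  by rewrite mulr_ge0// ?exprn_ge0// ltW.
have [n _ hn] := @exprn_gt_bound R 2 ((s - l) / h) (ltr1n _ 2).
apply: (all n); rewrite ls/=.
by move: hn; rewrite ltr_pdivrMr// => hn; lra.
Qed.

Lemma agree_indic (l a : R) : a < 0 ->
  (forall s, l <= s -> agree (fun x => expR (s * x))) ->
  agree (fun x => (x < a)%R%:R).
Proof.
move=> a0 al; pose c := ln 2 / - a.
have ln2 : 0 < ln 2 :> R by rewrite ln_gt0// ltr1n.
have c0 : 0 < c by rewrite divr_gt0// oppr_gt0.
pose N := (Num.truncn (l / c)).+1.
have lN : l <= N%:R * c.
  by have := truncnS_gt (l / c); rewrite ltr_pdivrMr// => /ltW.
(* The geometric sum gives [1 - (1 - y^N)^n = y^N * sum_(i < n) (1 - y^N)^i]. The extracted factor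
   [y^N = e^(N c x)] keeps every exponent at least [N c >= l], inside the ray where agreement is
   known. *)
pose p n : {poly R} :=
  (\sum_(i < n) (1 - 'X^N) ^+ i) * (1 - 'X^n) ^+ (n * 2 ^ n).
have pE n x : expR (N%:R * c * x) * (p n).[expR (c * x)] =
    (1 - (1 - expR (c * x) ^+ N) ^+ n) *
    (1 - expR (c * x) ^+ n) ^+ (n * 2 ^ n).
  rewrite -mulrA expRM_natl; set y := expR _.
  rewrite /p hornerM horner_sum mulrA; congr (_ * _); last first.
    by rewrite horner_exp !hornerE.
  rewrite -[RHS]opprB subrX1 -mulNr; congr (_ * _); first by ring.
  by apply: eq_bigr => i _; rewrite horner_exp !hornerE.
have y01 (x : R) : x < 0 -> 0 < expR (c * x) < 1.
  by move=> x0; rewrite expR_gt0/= -expR0 ltr_expR pmulr_rlt0.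
apply: (@agree_lim (fun n x => expR (N%:R * c * x) * (p n).[expR (c * x)])
  _ (fun=> 1)).
- move=> n; apply: agree_horner => i _; apply: al.
  by rewrite (le_trans lN)// lerDl mulr_ge0// ltW.
- exact: finite_measure_integrable_cst.
- exact: finite_measure_integrable_cst.
- move=> n x /y01 /andP[y0 y1]; rewrite pE.
  set y := expR _ in y0 y1 *.
  have yn01 k : 0 <= 1 - y ^+ k <= 1.
    by rewrite subr_ge0 exprn_ile1 ?(ltW y0) ?(ltW y1)//= gerBl exprn_ge0// ltW.
  rewrite normrM mulr_ile1// ger0_norm.
  + by rewrite gerBl exprn_ge0//; case/andP: (yn01 N).
  + by have /andP[? ?] := yn01 N; rewrite subr_ge0 exprn_ile1.
  + by have /andP[? ?] := yn01 n; rewrite exprn_ile1.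
  + by have /andP[? ?] := yn01 n; rewrite exprn_ge0.
- move=> x x0; under eq_cvg do rewrite pE.
  have -> : (x < a) = (expR (c * x) < 2^-1).
    rewrite -[2^-1]lnK ?posrE ?invr_gt0// ltr_expR lnV ?posrE//.
    rewrite /c mulrAC ltr_pdivrMr ?oppr_gt0// mulrNN mulrC.
    by rewrite [ln 2 * a]mulrC ltr_pM2r.
  by apply: cvg_step => //; exact: y01.
Qed.

Lemma agree_measure_ray (l a : R) : a < 0 ->
  (forall s, l <= s -> agree (fun x => expR (s * x))) ->
  m1 `]-oo, a[%classic = m2 `]-oo, a[%classic.
Proof.
move=> a0 /(agree_indic a0)[_ _].
have mE (m : probability R R) : (\int[m]_(x in neg) ((x < a)%R%:R)%:E = m `]-oo, a[%classic)%E.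
  transitivity (\int[m]_(x in neg) (\1_`]-oo, a[ x)%:E)%E.
    by apply: eq_integral => x _; rewrite indicE/= mem_setE in_itv.
  rewrite integral_indic// setIidl// => x /=; rewrite !in_itv/= => /lt_trans.
  exact.
by rewrite !mE.
Qed.

(** The rays are stable under intersection, generate the Borel sets and exhaust the line. *)
Lemma eq_measure_of_rays : (forall a, m1 `]-oo, a[%classic = m2 `]-oo, a[%classic) ->
  forall A, measurable A -> m1 A = m2 A.
Proof.
move=> ray; apply: (@measure_unique _ _ _ (@RGenInftyO.G R)
  (fun n => `]-oo, n%:R[%classic)) => //.
- exact: RGenInftyO.measurableE.
- move=> _ _ [a ->] [b ->]; exists (Num.min a b).
  by apply/seteqP; split => x /=; rewrite !in_itv/= lt_min => /andP.
- by move=> n; exists n%:R.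
- apply/seteqP; split => // x _; exists (Num.truncn x).+1 => //=.
  by rewrite in_itv/= truncnS_gt.
- by move=> _ [a ->]; exact: ray.
- by move=> n; rewrite (le_lt_trans (probability_le1 _ _))// ltry.
Qed.

End uniqueness.

(** * Exponential left tails from exponentially small probabilities of [S_n < 0] *)

Section exponential_tails.
Variable R : realType.
Implicit Types m : probability R R.
Local Notation neg := `]-oo, (0 : R)[%classic.
Local Notation pos := `[(0 : R), +oo[%classic.
Local Notation upto x := `]-oo, (x : R)]%classic.

Lemma integral_gt_truncate m (f : R -> \bar R) (T : \bar R) :
  measurable_fun setT f -> (forall x, (0 <= f x)%E) -> (T < \int[m]_x f x)%E ->
  exists n : nat, (T < \int[m]_(x in upto n%:R) f x)%E.
Proof.
move=> mf f0 Tf; apply: contrapT => /forallNP nT; move: Tf; apply/negP.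
rewrite -leNgt.
have <- : \bigcup_n (upto n%:R) = setT.
  apply/seteqP; split => // x _; exists (Num.truncn x).+1 => //=.
  by rewrite in_itv/= ltW// truncnS_gt.
have nd : nondecreasing_seq (fun n : nat => upto n%:R).
  move=> i j ij; apply/subsetPset => x /=; rewrite !in_itv/= => /le_trans; apply.
  by rewrite ler_nat.
have c := @ge0_nondecreasing_set_cvg_integral _ _ _ _ f m nd
  (fun=> measurable_itv _) (fun=> measurable_funTS mf) (fun _ x _ => f0 x).
rewrite -(cvg_lim _ c)//; apply: lime_le; first exact: cvgP c.
by apply: nearW => n; rewrite leNgt; apply/negP/nT.
Qed.

(** A truncation to [x <= n] already has integral above some [T' > T]. There
    [e^(s x) >= e^(- h n) e^(l x)]: for [x < 0] because [s <= l], for [0 <= x <= n] because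
    [s >= l - h]. The value at [l] may be infinite. *)
Lemma laplace_gt_left m (l T : R) : (T%:E < laplace m l)%E ->
  exists2 h : R, 0 < h & forall s : R, l - h <= s <= l -> (T%:E < laplace m s)%E.
Proof.
move=> Tl; have [T0|T0] := ltP T 0.
  exists 1; first exact: ltr01.
  by move=> s _; rewrite (lt_le_trans _ (laplace_ge0 _ _))// lte_fin.
have [T' TT' T'l] : exists2 T', T < T' & (T'%:E < laplace m l)%E.
  move: Tl; case: (laplace m l) => [r||]//; last first.
    by move=> _; exists (T + 1); rewrite ?ltry ?ltrDl.
  by rewrite lte_fin => Tr; exists ((T + r) / 2); rewrite ?lte_fin; lra.
have [n nT'] := integral_gt_truncate (@measurable_EFin_expRM R l setT)
  (fun x => EFin_expR_ge0 _) T'l.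
have T'0 : 0 < T' by lra.
(* Chosen so that [(1 - h n) T' >= T], hence [e^(- h n) T' >= T]; [n.+1] avoids dividing by zero. *)
pose h := (T' - T) / (n.+1%:R * T').
have n0 : 0 < n.+1%:R :> R by [].
have h0 : 0 < h by rewrite divr_gt0 ?mulr_gt0// subr_gt0.
exists h; first exact: h0.
move=> s /andP[hs sl].
have hn : T <= expR (- (h * n%:R)) * T'.
  have := expR_ge1Dx (- (h * n%:R)); rewrite -(ler_pM2r T'0); apply: le_trans.
  have : h * n.+1%:R * T' = T' - T.
    by rewrite /h; field; rewrite !gt_eqF.
  rewrite -natr1; have := mulr_gt0 h0 T'0; lra.
apply: (@le_lt_trans _ _ ((expR (- (h * n%:R)))%:E * T'%:E)%E).
  by rewrite -EFinM lee_fin.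
apply: (@lt_le_trans _ _ ((expR (- (h * n%:R)))%:E *
    \int[m]_(x in upto n%:R) (expR (l * x))%:E)%E).
  by rewrite lte_pmul2l// lte_fin expR_gt0.
rewrite -ge0_integralZl//.
apply: (@le_trans _ _ (\int[m]_(x in upto n%:R) (expR (s * x))%:E)%E).
  apply: ge0_le_integral => //.
  - apply/measurable_EFinP; apply: measurable_funM => //.
    exact: measurable_expRM.
  - move=> x /=; rewrite in_itv/= => xn; rewrite -EFinM lee_fin -expRD ler_expR.
    have [x0|x0] := leP 0 x.
      have := ler_wpM2l (ltW h0) xn.
      have : 0 <= (s - l + h) * x by rewrite mulr_ge0//; lra.
      by rewrite !mulrDl mulNr; lra.
    have : 0 <= (s - l) * x by apply: mulr_le0; lra.
    have : 0 <= h * n%:R by rewrite mulr_ge0// ltW.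
    by rewrite mulrBl; lra.
exact: ge0_subset_integral.
Qed.

Lemma mconv_ge m1 m2 (A B C : set R) : measurable A -> measurable B ->
  measurable C -> (forall x y, A x -> B y -> C (x + y)) ->
  (m1 A * m2 B <= mconv m1 m2 C)%E.
Proof.
move=> mA mB mC ABC; rewrite -product_measure1E// le_measure ?inE//.
- exact: measurableX.
- by rewrite -[X in measurable X]setTI; exact: measurable_addp.
- by move=> [x y] /= [Ax By]; exact: ABC.
Qed.

Lemma convn_upto_ge m (d M : R) n : 0 <= d -> (d%:E <= m (upto M))%E ->
  ((d ^+ n)%:E <= convn m n (upto (n%:R * M)%R))%E.
Proof.
move=> d0 dM; elim: n => [|n IH].
  by rewrite mul0r /= /dirac indicE mem_set//= in_itv/=.
apply: le_trans (_ : (m (upto M) * convn m n (upto (n%:R * M)%R) <= _)%E).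
  by rewrite exprS EFinM lee_pmul// lee_fin// exprn_ge0.
apply: mconv_ge => // x y /=; rewrite !in_itv/= -natr1 mulrDl mul1r; lra.
Qed.

Lemma laplace_pos_le1 m (l : R) : l <= 0 -> (laplace_pos m l <= 1)%E.
Proof.
move=> l0; rewrite -(@probability_setT _ _ _ m).
rewrite (@le_trans _ _ (m pos))//; last by rewrite le_measure// inE.
rewrite -[leRHS]mul1e -integral_cst//; apply: ge0_le_integral => //.
move=> x /=; rewrite in_itv/= andbT => x0; rewrite lee_fin -expR0 ler_expR.
exact: mulr_le0_ge0.
Qed.

Section half_line.
Variables (m : probability R R) (d : R).
Hypotheses (d0 : 0 < d) (d1 : d < 1).
Hypothesis small : forall n, (0 < n)%N -> (convn m n neg <= (d ^+ (2 * n))%:E)%E.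

(* A first step below [-nM] followed by n steps of size at most [M], each of
   probability at least [d], leads below 0. *)
Lemma tail_le : exists2 M : R, 0 < M &
  forall n, (m `]-oo, (- (n%:R * M))%R[%classic <= (d ^+ n)%:E)%E.
Proof.
have [k dk] : exists k : nat, (d%:E < m (upto k%:R))%E.
  have d1' : (d%:E < \int[m]_x cst 1%E x)%E.
    by rewrite integral_cst// mul1e [X in (_ < X)%E]probability_setT lte_fin.
  have [//|//|k] := integral_gt_truncate _ _ d1'.
  by rewrite integral_cst// mul1e => ?; exists k.
exists k.+1%:R => // n.
have dM : (d%:E <= m (upto k.+1%:R))%E.
  rewrite (le_trans (ltW dk))// le_measure ?inE// => x /=.
  by rewrite !in_itv/= => /le_trans; apply; rewrite ler_nat.
have dn0 : 0 < d ^+ n by rewrite exprn_gt0.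
have := convn_upto_ge n (ltW d0) dM; set M := k.+1%:R.
have c : (m `]-oo, (- (n%:R * M))%R[%classic * convn m n (upto (n%:R * M)%R)
    <= convn m n.+1 neg)%E.
  by apply: mconv_ge => // x y /=; rewrite !in_itv/=; lra.
have := le_trans c (small (ltn0Sn n)) => {}c dn.
(* The rate [d^2] in [small] pays for the [n] bounded steps and still leaves [d^n]. *)
have {}c : (m `]-oo, (- (n%:R * M))%R[%classic * (d ^+ n)%:E <= (d ^+ n * d ^+ n)%:E)%E.
  apply: le_trans (le_trans c _); first by rewrite lee_wpmul2l.
  by rewrite lee_fin -exprD addnn -mul2n ler_wiXn2l ?ltW// leq_mul2l leqnSn orbT.
by move: c; rewrite EFinM lee_pmul2r// lte_fin.
Qed.

(** With [e^(- l M) = w] and [1 < w < 1/d], the integrand grows by a factor [w] per length [M] to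
    the left while the tail shrinks by [d], so a geometric series of ratio [w d < 1] dominates. *)
Lemma laplace_finite_left : exists2 l : R, l < 0 & (laplace m l < +oo)%E.
Proof.
have [M M0 tail] := tail_le.
pose w := (1 + d^-1) / 2.
have di1 : 1 < d^-1 by rewrite invf_gt1.
have w1 : 1 < w by rewrite /w; lra.
have w0 : 0 < w by lra.
have wd : 0 < w * d < 1.
  have -> : w * d = (d + 1) / 2 by rewrite /w; field; rewrite gt_eqF.
  by have := d0; have := d1; lra.
pose l := - ln w / M.
have lnw : 0 < ln w by rewrite ln_gt0.
have l0 : l < 0 by rewrite /l mulNr oppr_lt0 divr_gt0.
exists l => //; rewrite laplace_split lte_add_pinfty//; last first.
  by rewrite (le_lt_trans (laplace_pos_le1 _ _))// ?ltry// ltW.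
(* For [n] the integer part of [- x / M], only [x <= - n M] is known, so the open ray of index
   [n.-1] is used; the exponent [n.+2] compensates for this shift. *)
pose F (n : nat) (x : R) := (w ^+ n.+2 * \1_(`]-oo, (- (n%:R * M))[%classic) x)%:E.
have mF n D : measurable_fun D (F n).
  by apply/measurable_EFinP; apply: measurable_funM.
have F0 n x : (0 <= F n x)%E.
  by rewrite lee_fin mulr_ge0// exprn_ge0// ltW.
apply: (@le_lt_trans _ _ (\int[m]_(x in neg) \sum_(0 <= n <oo) F n x)%E).
  apply: ge0_le_integral => //.
    exact: ge0_emeasurable_sum.
  move=> x /=; rewrite in_itv/= => x0.
  pose n := Num.truncn (- x / M).
  have xM0 : 0 <= - x / M by rewrite divr_ge0 ?ltW// oppr_gt0.
  have /andP[nx xn] := truncn_itv xM0; rewrite -/n in nx xn.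
  have lx : expR (l * x) <= w ^+ n.+1.
    rewrite -[w in leRHS]lnK// -expRM_natl ler_expR.
    rewrite (_ : l * x = (- x / M) * ln w); last by rewrite /l; ring.
    by rewrite ler_pM2r// ltW.
  have Fn : ((expR (l * x))%:E <= F n.-1 x)%E.
    rewrite /F lee_fin indicE mem_set ?mulr1.
      by rewrite (le_trans lx)// ler_weXn2l ?ltW//; case: (n).
    rewrite /= in_itv/=; move: nx; rewrite ler_pdivlMr//; case: (n) => [|k] /=.
      by rewrite mul0r oppr0.
    by rewrite -natr1 mulrDl mul1r; lra.
  apply: (le_trans Fn).
  apply: le_trans (@nneseries_lim_ge _ (F ^~ x) xpredT 0 n.-1.+1 _) => //.
  by rewrite big_nat_recr//= leeDr// sume_ge0.
rewrite integral_nneseries//.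
apply: (@le_lt_trans _ _ (w ^+ 2 / (1 - w * d))%:E); last by rewrite ltry.
apply: lime_le; first by apply: is_cvg_nneseries => n _ _; exact: integral_ge0.
apply: nearW => N.
have wd1 : `|w * d| < 1 by rewrite gtr0_norm; lra.
have wd0 : 0 < w * d by lra.
apply: le_trans (_ : (_ <= (series (geometric (w ^+ 2) (w * d)) N)%:E)%E) _; last first.
  by rewrite lee_fin geometric_le_lim// exprn_ge0// ltW.
rewrite /series /= -sumEFin; apply: lee_sum => n _ /=.
rewrite /F; under eq_integral do rewrite EFinM.
rewrite ge0_integralZl//; last first.
- by rewrite lee_fin exprn_ge0// ltW.
- by apply/measurable_EFinP; exact: measurable_indic.
rewrite integral_indic//.
apply: (@le_trans _ _ ((w ^+ n.+2)%:E * (d ^+ n)%:E)%E).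
  rewrite lee_wpmul2l ?lee_fin ?exprn_ge0 ?(ltW w0)//.
  by rewrite (le_trans _ (tail n))// le_measure ?inE//; exact: measurableI.
have powE (a b : R) : a ^+ 2 * (a * b) ^+ n = a ^+ n.+2 * b ^+ n.
  by rewrite exprMn mulrA -exprD.
by rewrite -EFinM lee_fin powE.
Qed.

(** Interpolates between the bound [d^(2n)] at exponent 0 and [L^n] at a far exponent. With
    [D = d^n], the two terms contribute [D^-1 d^(2n) = D] and [D^(k+1) L^n <= D]. *)
Lemma laplace_neg_convn_le : exists2 l : R, l < 0 & forall s : R, l <= s <= 0 ->
  forall n, (0 < n)%N -> (laplace_neg (convn m n) s <= (2 * d ^+ n)%:E)%E.
Proof.
have [l l0 lfin] := laplace_finite_left.
have lf : laplace m l \is a fin_num by rewrite ge0_fin_numE// laplace_ge0.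
pose L := fine (laplace m l).
have LE : laplace m l = L%:E by rewrite /L fineK.
have L0 : 0 <= L by rewrite /L fine_ge0// laplace_ge0.
(* With [d^k L <= 1], the factor [D^k] absorbs [L^n]. *)
have [k k0 Lk] := @exprn_gt_bound R d^-1 L (ltac:(by rewrite invf_gt1)).
have kL : d ^+ k * L <= 1.
  by rewrite mulrC -ler_pdivlMr ?exprn_gt0// mul1r -exprVn ltW.
exists (l / k.+2%:R) => [|s /andP[ls s0] n n0].
  by rewrite pmulr_llt0// invr_gt0.
set nu := convn m n; pose D := d ^+ n.
have D0 : 0 < D by rewrite exprn_gt0.
apply: (@le_trans _ _ (\int[nu]_(x in neg)
    ((D^-1)%:E + (D ^+ k.+1)%:E * (expR (l * x))%:E))%E).
  apply: ge0_le_integral => //.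
    apply/measurable_EFinP; apply: measurable_funD => //.
    by apply: measurable_funM => //; exact: measurable_expRM.
  move=> x /=; rewrite in_itv/= => x0; rewrite -EFinM -EFinD lee_fin.
  (* Interpolation: [E <= D^-1 + D^(k+1) E^(k+2)], according to [E D <= 1] or not. *)
  pose E := expR (l / k.+2%:R * x).
  have sE : expR (s * x) <= E by rewrite ler_expR ler_wnM2r// ltW.
  have -> : expR (l * x) = E ^+ k.+2.
    by rewrite -expRM_natl; congr expR; field.
  have E0 : 0 < E by exact: expR_gt0.
  apply: (le_trans sE); have [ED|ED] := leP (E * D) 1.
    rewrite ler_wpDr//; first by rewrite mulr_ge0// exprn_ge0// ltW.
    by rewrite -[leRHS]mul1r ler_pdivlMr.
  rewrite ler_wpDl//; first by rewrite invr_ge0 ltW.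
  by rewrite [E ^+ k.+2]exprS mulrCA -exprMn ler_peMr ?(ltW E0)// mulrC exprn_ege1// ltW.
rewrite ge0_integralD//; last 3 first.
- by move=> x _; rewrite lee_fin invr_ge0 ltW.
- by move=> x _; rewrite mule_ge0// lee_fin exprn_ge0// ltW.
- apply/measurable_EFinP; apply: measurable_funM => //.
  exact: measurable_expRM.
rewrite integral_cst// ge0_integralZl//; last first.
- by rewrite lee_fin exprn_ge0// ltW.
rewrite -/(laplace_neg nu l).
have -> : 2 * d ^+ n = D + D by rewrite /D; ring.
rewrite EFinD leeD//.
  apply: (@le_trans _ _ ((D^-1)%:E * (d ^+ (2 * n))%:E)%E).
    by rewrite lee_wpmul2l ?small// lee_fin invr_ge0 ltW.
  by rewrite -EFinM lee_fin mulnC exprM expr2 mulKf// gt_eqF.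
apply: (@le_trans _ _ ((D ^+ k.+1)%:E * (L ^+ n)%:E)%E).
  apply: lee_wpmul2l; first by rewrite lee_fin exprn_ge0// ltW.
  by rewrite EFin_expe -LE -laplace_convn laplace_split leeDl// laplace_pos_ge0.
rewrite -EFinM lee_fin exprS -mulrA ler_piMr ?(ltW D0)//.
by rewrite /D -exprM mulnC exprM -exprMn exprn_ile1// mulr_ge0// exprn_ge0// ltW.
Qed.

(** The transform is 1 > [d] at 0, so it stays above [d] slightly to the left; finiteness is the
    remainder bound at [n = 1]. *)
Lemma laplace_near0 : exists2 h : R, 0 < h & forall s : R, - h <= s <= 0 ->
  [/\ (d%:E < laplace m s)%E, (laplace m s < +oo)%E & forall n, (0 < n)%N ->
      (laplace_neg (convn m n) s <= (2 * d ^+ n)%:E)%E].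
Proof.
have [l l0 neg_le] := laplace_neg_convn_le.
have /laplace_gt_left[h h0 dl] : (d%:E < laplace m 0)%E.
  rewrite /laplace; under eq_integral do rewrite mul0r expR0.
  by rewrite integral_cst// mul1e [X in (_ < X)%E]probability_setT lte_fin.
exists (Num.min h (- l)); first by rewrite lt_min h0 oppr_gt0.
move=> s; rewrite lerNl le_min lerN2 => /andP[/andP[hs ls] s0].
have ls0 : l <= s <= 0 by apply/andP.
split.
- by apply: dl; rewrite sub0r lerNl hs.
- rewrite -laplace_convn1 laplace_split lte_add_pinfty//.
    by rewrite (le_lt_trans (neg_le _ ls0 1%N isT))// ltry.
  by rewrite (le_lt_trans (laplace_pos_le1 _ s0))// ltry.
- exact: neg_le.
Qed.

End half_line.

End exponential_tails.

(** * Equality of the transforms on an interval, and of the measures *)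

Section determination.
Variable R : realType.
Implicit Types m : probability R R.

Lemma same_pos_convpows_sym m1 m2 :
  same_pos_convpows m1 m2 -> same_pos_convpows m2 m1.
Proof. by move=> same n n0 A mA Apos; rewrite same. Qed.

Lemma eq_laplace_of_neg_le m1 m2 (s q C : R) : same_pos_convpows m1 m2 ->
  0 <= q -> 0 <= C -> (q%:E < laplace m1 s)%E -> (laplace m1 s < +oo)%E ->
  (forall n, (0 < n)%N -> (laplace_neg (convn m1 n) s <= (C * q ^+ n)%:E)%E) ->
  (forall n, (0 < n)%N -> (laplace_neg (convn m2 n) s <= (C * q ^+ n)%:E)%E) ->
  laplace m1 s = laplace m2 s.
Proof.
move=> same q0 C0 qs sfin neg1 neg2.
have close ma mb n : same_pos_convpows ma mb -> (0 < n)%N ->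
    (laplace_neg (convn ma n) s <= (C * q ^+ n)%:E)%E ->
    (laplace ma s ^+ n <= laplace mb s ^+ n + (C * q ^+ n)%:E)%E.
  move=> sab n0 na; rewrite -!laplace_convn !laplace_split (same_laplace_pos sab)//.
  rewrite addeC; apply: leeD => //.
  by rewrite leeDr// laplace_neg_ge0.
have same' := same_pos_convpows_sym same.
(* Finiteness passes to [m2] by the comparison at [n = 1]. *)
have sfin2 : (laplace m2 s < +oo)%E.
  have := close _ _ _ same' (ltn0Sn 0) (neg2 _ (ltn0Sn 0)).
  by move/le_lt_trans; apply; rewrite lte_add_pinfty// ltry.
have f1 : laplace m1 s \is a fin_num by rewrite ge0_fin_numE// laplace_ge0.
have f2 : laplace m2 s \is a fin_num by rewrite ge0_fin_numE// laplace_ge0.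
have E1 : laplace m1 s = (fine (laplace m1 s))%:E by rewrite fineK.
have E2 : laplace m2 s = (fine (laplace m2 s))%:E by rewrite fineK.
rewrite E1 E2; congr EFin; apply: (@eq_of_exprn_close R _ _ q C) => //.
- by move: qs; rewrite E1 lte_fin.
- by rewrite fine_ge0// laplace_ge0.
- move=> n n0; have := close _ _ _ same n0 (neg1 _ n0).
  by rewrite E1 E2 -!EFin_expe -EFinD lee_fin.
- move=> n n0; have := close _ _ _ same' n0 (neg2 _ n0).
  by rewrite E1 E2 -!EFin_expe -EFinD lee_fin.
Qed.

Lemma eq_of_eq_laplace m1 m2 (l h : R) : same_pos_convpows m1 m2 -> 0 < h ->
  (forall s, l <= s <= l + h ->
    laplace m1 s = laplace m2 s /\ (laplace m1 s < +oo)%E) ->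
  forall A, measurable A -> m1 A = m2 A.
Proof.
move=> same h0 eqL.
have same1 A : measurable A -> A `<=` `[(0 : R), +oo[ -> m1 A = m2 A.
  by move=> mA Apos; rewrite -(convn1 m1 mA) -(convn1 m2 mA) (same_convn same).
have int (m : probability R R) s : (laplace m s < +oo)%E ->
    m.-integrable `]-oo, (0 : R)[ (EFin \o (fun x => expR (s * x))).
  move=> fin; apply/integrableP; split; first exact: measurable_EFin_expRM.
  under eq_integral do rewrite /= ger0_norm ?expR_ge0//.
  apply: le_lt_trans fin; rewrite laplace_split leeDl// laplace_pos_ge0//.
have ag s : l <= s <= l + h -> agree m1 m2 (fun x => expR (s * x)).
  move=> /eqL[E fin]; split; [exact: int|by apply: int; rewrite -E|].
  have P : laplace_pos m1 s = laplace_pos m2 s.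
    exact: eq_measure_integral.
  have Pfin : laplace_pos m2 s \is a fin_num.
    rewrite ge0_fin_numE ?laplace_pos_ge0// -P.
    by apply: le_lt_trans fin; rewrite laplace_split leeDr// laplace_neg_ge0.
  move: E; rewrite !laplace_split P => /(congr1 (fun z => z - laplace_pos m2 s)%E).
  by rewrite !addeK.
apply: eq_measure_of_rays => a; have [a0|a0] := ltP a 0.
  exact: agree_measure_ray (agree_ray h0 ag).
rewrite -setCitvr !probability_setC// same1// => x /=.
by rewrite !in_itv/= !andbT; exact: le_trans.
Qed.

Lemma eq_of_cond_b m1 m2 : same_pos_convpows m1 m2 -> cond_b m1 ->
  forall A, measurable A -> m1 A = m2 A.
Proof.
move=> same [l [l0 [l1 lfin]]].
have [h h0 hl] := laplace_gt_left l1.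
(* Keeping [s >= 0] bounds both remainders by 1, whatever the measure. *)
pose k := Num.min h l.
have k0 : 0 < k by rewrite lt_min h0 l0.
apply: (@eq_of_eq_laplace _ _ (l - k) k same k0) => s.
rewrite subrK => /andP[ks sl].
have s0 : 0 <= s by rewrite (le_trans _ ks)// subr_ge0 ge_min lexx orbT.
have s1 : (1 < laplace m1 s)%E.
  by apply: hl; rewrite sl andbT (le_trans _ ks)// lerD2l lerN2 ge_min lexx.
have sfin : (laplace m1 s < +oo)%E.
  rewrite laplace_split; apply: lte_add_pinfty.
    by rewrite (le_lt_trans (laplace_neg_le1 _ s0))// ltry.
  apply: (@le_lt_trans _ _ (laplace_pos m1 l)).
    apply: ge0_le_integral => //.
    move=> x /=; rewrite in_itv/= andbT => x0.
    by rewrite lee_fin ler_expR ler_wpM2r.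
  by apply: le_lt_trans lfin; rewrite laplace_split leeDr// laplace_neg_ge0.
split => //; apply: (@eq_laplace_of_neg_le _ _ _ 1 1) => // n _.
  by rewrite expr1n mulr1 laplace_neg_le1.
by rewrite expr1n mulr1 laplace_neg_le1.
Qed.

Lemma eq_of_cond_a m1 m2 : same_pos_convpows m1 m2 -> cond_a m1 ->
  forall A, measurable A -> m1 A = m2 A.
Proof.
move=> same [l [l0 l1]].
have lf : laplace m1 l \is a fin_num.
  by rewrite ge0_fin_numE ?laplace_ge0// (lt_trans l1)// ltry.
pose c := fine (laplace m1 l).
have cE : laplace m1 l = c%:E by rewrite /c fineK.
have c0 : 0 <= c by rewrite /c fine_ge0// laplace_ge0.
have c1 : c < 1 by move: l1; rewrite cE lte_fin.
(* The mean of 1 and [c] satisfies [c <= d^2] and [d < 1], so the Markov bound [P(S_n < 0) <= c^n]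
   has the form [d^(2n)]. *)
pose d := (1 + c) / 2.
have d0 : 0 < d by rewrite /d; lra.
have d1 : d < 1 by rewrite /d; lra.
have cd : c <= d ^+ 2.
  by rewrite -subr_ge0 (_ : _ - _ = ((1 - c) / 2) ^+ 2) ?sqr_ge0// /d; field.
have small1 n : (0 < n)%N ->
    (convn m1 n `]-oo, 0%R[%classic <= (d ^+ (2 * n))%:E)%E.
  move=> _; apply: (@le_trans _ _ (c ^+ n)%:E); last first.
    by rewrite lee_fin exprM lerXn2r// nnegrE// exprn_ge0// ltW.
  rewrite EFin_expe -cE -laplace_convn.
  apply: (@le_trans _ _ (laplace_neg (convn m1 n) l)); last first.
    by rewrite laplace_split leeDl// laplace_pos_ge0.
  rewrite -[leLHS]mul1e -integral_cst//; apply: ge0_le_integral => //.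
  move=> x /=; rewrite in_itv/= => x0; rewrite lee_fin -expR0 ler_expR.
  by rewrite mulr_le0// ltW.
(* Total mass one turns agreement on [[0, +oo[] into equality of [P(S_n < 0)], so [m2] inherits the
   decay without condition (a) being assumed for it. *)
have small2 n : (0 < n)%N ->
    (convn m2 n `]-oo, 0%R[%classic <= (d ^+ (2 * n))%:E)%E.
  by move=> n0; rewrite -(same_neg same n0) small1.
have [h1 h10 H1] := laplace_near0 d0 d1 small1.
have [h2 h20 H2] := laplace_near0 d0 d1 small2.
pose k := Num.min h1 h2.
have k0 : 0 < k by rewrite lt_min h10 h20.
apply: (@eq_of_eq_laplace _ _ (- k) k same k0) => s.
rewrite addrC subrr => /andP[ks s0].
have [|s1 fin1 neg1] := H1 s.
  by rewrite s0 andbT (le_trans _ ks)// lerN2 ge_min lexx.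
have [|_ _ neg2] := H2 s.
  by rewrite s0 andbT (le_trans _ ks)// lerN2 ge_min lexx orbT.
by split => //; apply: (@eq_laplace_of_neg_le _ _ _ d 2) => //; exact: ltW.
Qed.

Lemma eq_laplace m1 m2 : (forall A, measurable A -> m1 A = m2 A) ->
  laplace m1 = laplace m2.
Proof.
by move=> E; apply/funext => l; apply: eq_measure_integral => A mA _; exact: E.
Qed.

End determination.

Theorem theorem2p7 (R : realType) (mu : probability R R) :
  ~ (msupport mu `<=` `]-oo, 0%R[) ->
  (forall mu1 : probability R R, same_pos_convpows mu1 mu ->
     (cond_a mu1 <-> cond_a mu) /\ (cond_b mu1 <-> cond_b mu)) /\
  (cond_a mu \/ cond_b mu ->
     forall mu1 : probability R R, same_pos_convpows mu1 mu ->
       forall A : set R, measurable A -> mu1 A = mu A).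
Proof.
move=> _; split=> [mu1 same|cond mu1 same A mA].
  have same' := same_pos_convpows_sym same.
  (* Whichever of the two measures satisfies the condition, uniqueness applies from its side, so the
     transforms coincide and the condition transfers. *)
  split; split=> cond.
  - by rewrite /cond_a -(eq_laplace (eq_of_cond_a same cond)).
  - by rewrite /cond_a -(eq_laplace (eq_of_cond_a same' cond)).
  - by rewrite /cond_b -(eq_laplace (eq_of_cond_b same cond)).
  - by rewrite /cond_b -(eq_laplace (eq_of_cond_b same' cond)).
have same' := same_pos_convpows_sym same; apply/esym.
case: cond => [ca|cb]; first exact: eq_of_cond_a same' ca _ mA.
exact: eq_of_cond_b same' cb _ mA.
Qed.
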